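(* If there exists a Barker sequence of odd length $n$, where $n>1$, then $n\in\{3,5,7,11,13\}$.
   Context: A binary sequence $A$ of length $n>1$ is an element of $\{-1,1\}^n$; its $k$-th entry is written $A(k)$, for $1\le k\le n$. For an integer $u$ with $0\le u<n$, the aperiodic autocorrelation of $A$ at shift $u$ is $C(u)=\sum_{k=1}^{n-u}A(k)A(k+u)$. A Barker sequence of length $n$ is a binary sequence $A$ of length $n>1$ such that $|C(u)|\le 1$ for every $u$ with $1\le u<n$. *)

(* Defs.v *)
From mathcomp Require Import all_boot all_order all_algebra.

Set Implicit Arguments.
Unset Strict Implicit.
Unset Printing Implicit Defensive.

Import Order.TTheory GRing.Theory Num.Theory.
Local Open Scope ring_scope.

(* A sequence of length n is an n-tuple of integers. Tuples are numbered from 0,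
   so the k-th entry A(k), 1 <= k <= n, is at position k.-1; [entry A k] is
   used only in that range (it is junk for k = 0 and k > n). *)
Definition entry (n : nat) (A : n.-tuple int) (k : nat) : int :=
  nth 0 A k.-1.

Definition binary_sequence (n : nat) (A : n.-tuple int) : Prop :=
  forall k : nat, (1 <= k <= n)%N -> entry A k = -1 \/ entry A k = 1.

(* Meaningful for 0 <= u < n. *)
Definition autocorrelation (n : nat) (A : n.-tuple int) (u : nat) : int :=
  \sum_(1 <= k < (n - u).+1) entry A k * entry A (k + u).

Definition barker_sequence (n : nat) (A : n.-tuple int) : Prop :=
  [/\ (1 < n)%N, binary_sequence A
    & forall u : nat, (1 <= u < n)%N -> `|autocorrelation A u| <= 1].

(* Main.v *)
Require Import Defs.
From mathcomp Require Import all_boot all_order all_algebra.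
From mathcomp Require Import zify ring.

(** Let [a 0, ..., a (n-1)] be a Barker sequence of odd length [n], and let
[A(x)] be the polynomial with these coefficients.

Counting signs modulo 4 determines every autocorrelation: [C(u)] is 0 for odd
[u] and [e] for even [u] with [0 < u < n], where [e] is the sign congruent to
[n] modulo 4 ([barker_acorr]); it also gives the skew-symmetry
[a_u a_(n-1-u) = e (-1)^u] ([barker_skew]). Reading [C(n-1-N)] through this
symmetry turns it into a coefficient of [A(x) A(-x)], so that [A(x) A(-x)] and
[1 / (1 - x^2)] agree below degree [n-1] ([barker_conv]).

Negating the sequence or every other term of it preserves the Barker property,
so one may assume [a_0 = a_1 = 1]. Then [A(x) (1 - x) = 1 + 2 D(x)] below
degree [n], where the coefficients [d_k] of [D] are 0, 1 or -1 and record the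
sign changes, and [(1 + 2 D(x)) (1 + 2 D(-x))] agrees with 1 below degree
[n-1]. In even degree [N <= n-2] this says that
[d_N + \sum_(i <= N) (-1)^i d_i d_(N-i) = 0] ([jump_conv]). Consequences:
- modulo 2, [d_(2k)] vanishes exactly when [d_k] does ([jump_double]);
- the first [p] with [d_p != 0] is odd ([first_jump_odd]);
- every [q <= n-2-p] with [d_q != 0] is a multiple of [p]: for the least
  exception [q], the identity in degree [p + q] reduces to
  [d_(p+q) = 2 d_p d_q], which is even and nonzero ([jumps_multiple]).

Skew-symmetry also says that exactly one of [d_k], [d_(n-k)] vanishes. So if
[j >= 3] is odd and [d_j = 0], then [d_(n-j)], hence [d_((n-j)/2)], is nonzero;
for [j = 3] this bounds [p] by [(n-3)/2], and then [p] divides [(n-j)/2]. Two values of [j] that differ by 2 or 4 are then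
incompatible, [p] being odd and greater than 1; such values exist as soon as
[n >= 9], except for [n = 9], which doubling excludes, and for [n = 11] and
[n = 13] ([jump_pattern_length]). *)

Set Implicit Arguments.
Unset Strict Implicit.
Unset Printing Implicit Defensive.
Import Order.TTheory GRing.Theory Num.Theory.
Local Open Scope ring_scope.

(** * Autocorrelations modulo 4 *)

Definition signs (n : nat) (a : nat -> int) : Prop :=
  forall k, (k < n)%N -> a k = 1 \/ a k = -1.

(** Autocorrelation with terms numbered from 0; on functions rather than tuples,
so that products with alternating signs stay in the same type. *)
Definition acorr (n : nat) (a : nat -> int) (u : nat) : int :=
  \sum_(0 <= k < n - u) a k * a (k + u)%N.

Definition barker (n : nat) (a : nat -> int) : Prop :=
  signs n a /\ forall u, (0 < u < n)%N -> `|acorr n a u| <= 1.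

Definition acorr_prod (n : nat) (a : nat -> int) (u : nat) : int :=
  \prod_(0 <= k < n - u) (a k * a (k + u)%N).

Lemma signs_prod m (x : nat -> int) :
  signs m x -> \prod_(0 <= k < m) x k = 1 \/ \prod_(0 <= k < m) x k = -1.
Proof.
elim: m => [|m IHm] sx; first by left; rewrite big_nil.
rewrite big_nat_recr //=.
have [|->|->] := IHm; first by move=> k km; apply: sx; lia.
  by have [//|->|->] := sx m; [left | right].
by have [//|->|->] := sx m; [right | left].
Qed.

(** Each minus sign lowers the sum by 2, so modulo 4 only the parity of their
number matters, and the product records that parity. *)
Lemma sum_signs_mod4 m (x : nat -> int) : signs m x ->
  (4 %| \sum_(0 <= k < m) x k - m%:Z - \prod_(0 <= k < m) x k + 1)%Z.
Proof.
elim: m => [|m IHm] sx; first by rewrite !big_nil.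
have sx' : signs m x by move=> k km; apply: sx; lia.
rewrite !big_nat_recr //=; move: (IHm sx').
move: (\sum_(0 <= k < m) x k) => S.
by case: (signs_prod sx') => ->; have [//|->|->] := sx m; lia.
Qed.

Lemma signs_acorr n a u :
  signs n a -> signs (n - u) (fun k => a k * a (k + u)%N).
Proof.
move=> sa k ku; have [|->|->] := sa k; first by lia.
  by have [|->|->] := sa (k + u)%N; [lia | left | right].
by have [|->|->] := sa (k + u)%N; [lia | right | left].
Qed.

Lemma acorr_mod4 n a u : signs n a -> (u <= n)%N ->
  (4 %| acorr n a u - n%:Z + u%:Z - acorr_prod n a u + 1)%Z.
Proof.
move=> sa un; have := sum_signs_mod4 (signs_acorr (u := u) sa).
rewrite -/(acorr n a u) -/(acorr_prod n a u).
by move: (acorr n a u) (acorr_prod n a u) => C P; lia.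
Qed.

Lemma acorr_prodE n a u : (u <= n)%N ->
  acorr_prod n a u = (\prod_(0 <= k < n - u) a k) * \prod_(u <= k < n) a k.
Proof.
move=> un; rewrite /acorr_prod big_split /=; congr (_ * _).
by rewrite -{3}[u]add0n big_addn.
Qed.

(** Passing from shift [u] to [u + 1] drops one term from each end of the range:
consecutive sign products compare [a u] with its mirror image. *)
Lemma acorr_prodS n a u : (u < n)%N ->
  acorr_prod n a u = acorr_prod n a u.+1 * (a u * a (n.-1 - u)%N).
Proof.
move=> un; rewrite !acorr_prodE //; last exact: ltnW.
have -> : (n - u = (n - u.+1).+1)%N by lia.
rewrite big_nat_recr //= (big_ltn un).
have -> : (n - u.+1 = n.-1 - u)%N by lia.
ring.
Qed.

(** The two products together contain every [a k] exactly twice. *)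
Lemma acorr_prod_rev n a u : signs n a -> (u <= n)%N ->
  acorr_prod n a (n - u) = acorr_prod n a u.
Proof.
move=> sa un.
have key : acorr_prod n a (n - u) * acorr_prod n a u = 1.
  rewrite !acorr_prodE ?leq_subr // subKn //.
  set p1 := \prod_(0 <= i < u) _; set p2 := \prod_(n - u <= i < n) _.
  set p3 := \prod_(0 <= i < n - u) _; set p4 := \prod_(u <= i < n) _.
  have -> : p1 * p2 * (p3 * p4) = (p1 * p4) * (p3 * p2) by ring.
  rewrite -!big_cat_nat ?leq_subr //=.
  by case: (signs_prod sa) => ->.
move: key; case: (signs_prod (signs_acorr (u := u) sa));
by rewrite -/(acorr_prod _ _ _) => ->; lia.
Qed.

(** [C(u)] has [n - u] terms, an even number, so [|C(u)| <= 1] leaves only 0. *)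
Lemma barker_acorr_odd n a u : barker n a -> odd n -> odd u -> (u <= n)%N ->
  acorr n a u = 0.
Proof.
move=> [sa Ca] on ou un; have := acorr_mod4 sa un.
case: (ltnP u n) => [ltun|leun]; last first.
  by rewrite /acorr (_ : (n - u)%N = 0%N) ?big_nil //; lia.
have := Ca u; rewrite ltun.
case: (signs_prod (signs_acorr (u := u) sa));
by rewrite -/(acorr_prod _ _ _) => ->; lia.
Qed.

(** The shift [n - u] is odd, so [C(n - u) = 0]; this fixes the sign product at
[n - u], which is also the sign product at [u], and thereby [C(u)] modulo 4. *)
Lemma barker_acorr_even n a u : barker n a -> odd n -> ~~ odd u -> (u < n)%N ->
  (4 %| acorr n a u - n%:Z)%Z /\ (4 %| acorr_prod n a u - u%:Z - 1)%Z.
Proof.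
move=> bn on eu un; have [sa _] := bn.
have := acorr_mod4 sa (ltnW un).
have := acorr_mod4 sa (leq_subr u n).
rewrite acorr_prod_rev ?(ltnW un) // (barker_acorr_odd bn on) ?leq_subr //;
  last by lia.
by move: (acorr n a u) (acorr_prod n a u) => C P; lia.
Qed.

(** [(-1) ^+ n./2] is the sign [e] congruent to [n] modulo 4. *)
Lemma sign_mod4 n : odd n -> (4 %| (-1) ^+ n./2 - n%:Z)%Z.
Proof.
by move=> on; rewrite -signr_odd; case E: (odd n./2);
  rewrite ?expr1 ?expr0; lia.
Qed.

Lemma barker_acorr n a u : barker n a -> odd n -> (0 < u < n)%N ->
  acorr n a u = (-1) ^+ n./2 *+ ~~ odd u.
Proof.
move=> bn on /andP[u0 un]; case: (boolP (odd u)) => [ou|eu].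
  by rewrite (barker_acorr_odd bn) // ltnW.
have [h _] := barker_acorr_even bn on eu un.
have := sign_mod4 on; have := bn.2 u; rewrite u0 un mulr1n.
rewrite -signr_odd; case: (odd _); rewrite ?expr1 ?expr0; lia.
Qed.

(** The product on the left is the ratio of the sign products at [u] and [u + 1];
one of these shifts is even and the other odd, so both products are known. *)
Lemma barker_skew n a u : barker n a -> odd n -> (u < n)%N ->
  a u * a (n.-1 - u)%N = (-1) ^+ n./2 * (-1) ^+ u.
Proof.
move=> bn on un; have [sa _] := bn.
have := acorr_prodS a un.
have hP v : acorr_prod n a v = 1 \/ acorr_prod n a v = -1.
  exact: signs_prod (signs_acorr sa).
have hz : a u * a (n.-1 - u)%N = 1 \/ a u * a (n.-1 - u)%N = -1.
  have [//|->|->] := sa u; have [|->|->] := sa (n.-1 - u)%N; try lia.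
have := sign_mod4 on; rewrite -signr_odd -[_ ^+ u]signr_odd.
have := acorr_mod4 sa un; have := acorr_mod4 sa (ltnW un).
case: (boolP (odd u)) => ou.
  have eu1 : ~~ odd u.+1 by rewrite /= ou.
  have lt_u1n : (u.+1 < n)%N by lia.
  have [h1 h2] := barker_acorr_even bn on eu1 lt_u1n.
  have := barker_acorr_odd bn on ou (ltnW un).
  case: (hP u) h1 h2 => ->; case: (hP u.+1) => ->; case: hz => ->;
  case: (odd _); rewrite ?expr1 ?expr0; lia.
have [h1 h2] := barker_acorr_even bn on ou un.
have := barker_acorr_odd bn on (u := u.+1) ou un.
case: (hP u) h1 h2 => ->; case: (hP u.+1) => ->; case: hz => ->;
case: (odd _); rewrite ?expr1 ?expr0; lia.
Qed.

(** * The self-convolution of a Barker sequence *)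

(** This is the coefficient of [x^N] in [A(x) A(-x)]. By skew-symmetry
[a (k + u)], for [u = n - 1 - N], is up to sign [a (N - k)], so the sum is
[C(u)] up to sign. *)
Lemma barker_conv n a N : barker n a -> odd n -> (N.+1 < n)%N ->
  \sum_(0 <= i < N.+1) (-1) ^+ i * a i * a (N - i)%N = (~~ odd N)%:R.
Proof.
move=> bn on lt_Nn; have [sa _] := bn.
have u_range : (0 < n.-1 - N < n)%N by lia.
have := barker_acorr bn on u_range.
have -> : odd (n.-1 - N) = odd N by lia.
rewrite /acorr; have -> : (n - (n.-1 - N) = N.+1)%N by lia.
set e := (-1) ^+ n./2.
have ee : e * e = 1 by rewrite /e -expr2 sqrr_sign.
have -> : \sum_(0 <= k < N.+1) a k * a (k + (n.-1 - N))%N =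
    e * (-1) ^+ N * \sum_(0 <= i < N.+1) (-1) ^+ i * a i * a (N - i)%N.
  rewrite mulr_sumr; apply: eq_big_nat => k /= kN.
  have lt_n : (N - k < n)%N by lia.
  have := barker_skew bn on lt_n.
  have -> : (n.-1 - (N - k) = k + (n.-1 - N))%N by lia.
  have -> : (-1) ^+ N = (-1) ^+ (N - k) * (-1) ^+ k :> int.
    by rewrite -exprD subnK //; lia.
  have kk : (-1) ^+ k * (-1) ^+ k = 1 :> int by rewrite -expr2 sqrr_sign.
  rewrite -/e; move: (_ ^+ k) kk => s ss; move: (_ ^+ _) => t h.
  have -> : e * (t * s) * (s * a k * a (N - k)%N)
    = e * t * (s * s) * a k * a (N - k)%N by ring.
  have aa : a (N - k)%N * a (N - k)%N = 1 by have [->|->] := sa _ lt_n.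
  rewrite ss -h -[LHS]mul1r -aa; ring.
rewrite -signr_odd; move: (\sum_(_ <= _ < _) _) => S h.
have SE s : e * (e * s * S) = s * S by rewrite -[RHS]mul1r -ee; ring.
move: h => /(congr1 ( *%R e)); rewrite SE.
case: (odd N); rewrite ?expr1 ?expr0 /= ?mulr1n ?mulr0n ?mulr0 ?ee; lia.
Qed.

Lemma coefM_ext (p p' q q' : {poly int}) N :
    (forall i, (i <= N)%N -> p`_i = p'`_i) ->
    (forall i, (i <= N)%N -> q`_i = q'`_i) ->
  (p * q)`_N = (p' * q')`_N.
Proof.
move=> hp hq; rewrite !coefM; apply: eq_bigr => i _.
by rewrite hp ?hq ?leq_subr // -ltnS ltn_ord.
Qed.

(** Half the difference [a k - a k.-1] for signs. At [k = 0] both sides of the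
test coincide, which makes [jump a 0 = 0]; the constant term of [A(x) (1 - x)]
is kept apart from the jumps. *)
Definition jump (a : nat -> int) (k : nat) : int :=
  if a k == a k.-1 then 0 else a k.

Lemma jump_diff n a k : signs n a -> (0 < k < n)%N ->
  a k - a k.-1 = 2 * jump a k.
Proof.
move=> sa kn; rewrite /jump.
have [|->|->] := sa k; first by lia.
  by have [|->|->] := sa k.-1; first by lia.
by have [|->|->] := sa k.-1; first by lia.
Qed.

(** Both ends of the sum vanish because [jump a 0 = 0]. The identity is a quarter
of the coefficient of [x^N] in [(1 + 2 D(x)) (1 + 2 D(-x))], the two linear
terms contributing [2 d_N] each as [N] is even. *)
Lemma jump_conv n a N : barker n a -> odd n -> a 0%N = 1 -> (N.+1 < n)%N ->
    ~~ odd N ->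
  jump a N + \sum_(0 <= i < N.+1) (-1) ^+ i * jump a i * jump a (N - i)%N = 0.
Proof.
move=> bn on a0 lt_Nn eN; have [sa _] := bn.
(* A' and D' are A(-x) and D(-x). *)
pose A := \poly_(i < n) a i; pose A' := \poly_(i < n) ((-1) ^+ i * a i).
pose D := \poly_(i < n) jump a i; pose D' := \poly_(i < n) ((-1) ^+ i * jump a i).
have AA' M : (M.+1 < n)%N -> (A * A')`_M = (~~ odd M)%:R.
  move=> Mn; rewrite -(barker_conv bn on Mn) coefMr big_mkord.
  apply: eq_bigr => i _; rewrite !coef_poly.
  have iN := ltn_ord i.
  by rewrite !ifT; [ring | lia | lia].
have E1 : ((A * (1 - 'X)) * (A' * (1 + 'X)))`_N = (N == 0)%:R.
  have -> : (A * (1 - 'X)) * (A' * (1 + 'X)) = A * A' - A * A' * 'X^2 by ring.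
  rewrite coefB coefMXn AA' //.
  case: (ltnP N 2) => N2; first by case: N N2 eN {lt_Nn} => [|[|]].
  rewrite AA'; last by lia.
  have -> : odd (N - 2) = odd N by lia.
  by rewrite subrr; case: N N2 {eN lt_Nn}.
have E2 : ((A * (1 - 'X)) * (A' * (1 + 'X)))`_N
    = ((1 + D *+ 2) * (1 + D' *+ 2))`_N.
  apply: coefM_ext => -[|i] iN.
  - rewrite mulrBr mulr1 coefB coefMX coefD coef1 coefMn !coef_poly.
    by rewrite (ltn_trans _ lt_Nn) //= a0 /jump eqxx.
  - rewrite mulrBr mulr1 coefB coefMX coefD coef1 coefMn !coef_poly /=.
    have -> : (i.+1 < n)%N by lia.
    have -> : (i < n)%N by lia.
    have /= -> := @jump_diff n a i.+1 sa; last by lia.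
    ring.
  - rewrite mulrDr mulr1 coefD coefMX coefD coef1 coefMn !coef_poly.
    by rewrite (ltn_trans _ lt_Nn) //= a0 /jump eqxx.
  - rewrite mulrDr mulr1 coefD coefMX coefD coef1 coefMn !coef_poly /=.
    have -> : (i.+1 < n)%N by lia.
    have -> : (i < n)%N by lia.
    have ji : a i.+1 - a i = 2 * jump a i.+1.
      by apply: (@jump_diff n a i.+1 sa); lia.
    have -> : (-1) ^+ i.+1 * jump a i.+1 *+ 2 = (-1) ^+ i.+1 * (a i.+1 - a i).
      by rewrite ji; ring.
    by rewrite exprS; ring.
have E3 : ((1 + D *+ 2) * (1 + D' *+ 2))`_N
    = (N == 0)%:R + 4 * (jump a N + (D * D')`_N).
  have -> : (1 + D *+ 2) * (1 + D' *+ 2) = 1 + D *+ 2 + D' *+ 2 + (D * D') *+ 4.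
    by ring.
  rewrite 3!coefD 3!coefMn coef1.
  rewrite [D`_N]coef_poly [D'`_N]coef_poly (ltnW lt_Nn).
  rewrite -signr_odd (negPf eN) expr0; ring.
have -> : \sum_(0 <= i < N.+1) (-1) ^+ i * jump a i * jump a (N - i)%N
    = (D * D')`_N.
  rewrite coefMr big_mkord; apply: eq_bigr => i _; rewrite !coef_poly.
  have iN := ltn_ord i.
  by rewrite !ifT; [ring | lia | lia].
move: E3; rewrite -E2 E1; move: (jump a N + _) => x; lia.
Qed.

(** * Consequences of the jump identity *)

Lemma sum_symmetric k (F : nat -> int) :
    (forall i, (i <= k.*2)%N -> F (k.*2 - i)%N = F i) ->
  \sum_(0 <= i < k.*2.+1) F i = F k + (\sum_(0 <= i < k) F i) *+ 2.
Proof.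
move=> Fsym.
rewrite (@big_cat_nat _ _ _ k) //=; last by lia.
rewrite [X in _ + X = _]big_ltn; last by lia.
rewrite -[k.+1]add0n big_addn [X in _ + (_ + X)]big_nat_rev /=.
have -> : (k.*2.+1 - (0 + k.+1) = k)%N by lia.
have -> : \sum_(0 <= i < k) F (0 + k - i.+1 + (0 + k.+1))%N = \sum_(0 <= i < k) F i.
  apply: eq_big_nat => i ik; rewrite -Fsym; last by lia.
  by congr F; lia.
by rewrite mulr2n; ring.
Qed.

Definition jump_identity (L : nat) (d : nat -> int) : Prop :=
  forall N, (N <= L)%N -> ~~ odd N ->
    d N + \sum_(0 <= i < N.+1) (-1) ^+ i * d i * d (N - i)%N = 0.

(** In even degree the summands [i] and [N - i] are equal, so only the middle one
counts modulo 2. *)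
Lemma jump_identity_half L d k : jump_identity L d -> (k.*2 <= L)%N ->
  d k.*2 + (-1) ^+ k * d k * d k
    + (\sum_(0 <= i < k) (-1) ^+ i * d i * d (k.*2 - i)%N) *+ 2 = 0.
Proof.
move=> dL kL; rewrite -[RHS](dL _ kL) ?odd_double // -addrA; congr (_ + _).
rewrite (@sum_symmetric k (fun i => (-1) ^+ i * d i * d (k.*2 - i)%N)); last first.
  move=> i ik; rewrite subKn // -[in LHS]signr_odd.
  have -> : odd (k.*2 - i) = odd i by lia.
  by rewrite signr_odd; ring.
by have -> : (k.*2 - k = k)%N by lia.
Qed.

(** Modulo 2 the jump identity reads [d_(2k) + d_k ^ 2 = 0]. *)
Lemma jump_double L d k : jump_identity L d ->
    (forall i, (i <= L)%N -> `|d i| <= 1) -> (k.*2 <= L)%N ->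
  (d k.*2 == 0) = (d k == 0).
Proof.
move=> dL d1 kL; have := jump_identity_half dL kL.
have d1_2k := d1 _ kL; have d1_k : `|d k| <= 1 by apply: d1; lia.
rewrite -signr_odd mulr2n; move: (\sum_(_ <= _ < _) _) => S.
have [->|[->|->]] : d k = 0 \/ d k = 1 \/ d k = -1 by lia.
- by case: (odd k); rewrite ?expr1 ?expr0; lia.
- by case: (odd k); rewrite ?expr1 ?expr0; lia.
- by case: (odd k); rewrite ?expr1 ?expr0; lia.
Qed.

(** In degree [p] every summand involves a jump before [p], so an even [p] would
give [d p = 0]. *)
Lemma first_jump_odd L d p : jump_identity L d -> (p <= L)%N ->
    d p != 0 -> (forall i, (i < p)%N -> d i = 0) -> d 0%N = 0 ->
  odd p.
Proof.
move=> dL pL dp0 dlt d0; apply: contraNT dp0 => ep.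
have := dL p pL ep; rewrite big1_seq ?addr0 => [->//|i].
rewrite mem_index_iota => /andP[_] ip.
case: (ltnP i p) => [/dlt -> |pi]; first by rewrite mulr0 mul0r.
have -> : (p - i = 0)%N by lia.
by rewrite d0 mulr0.
Qed.

(** For the least exception [q], two earlier jumps cannot add up to [q], nor to
[p + q], since both would be multiples of [p]. Degree [q] then shows that [q]
is odd, and in degree [p + q] only the summands [p] and [q] survive, which
gives [d (p + q) = 2 * d p * d q], too large for a jump. *)
Lemma jumps_multiple L d p : jump_identity L d ->
    (forall i, (i <= L)%N -> `|d i| <= 1) -> d 0%N = 0 -> (p <= L)%N ->
    d p != 0 -> (forall i, (i < p)%N -> d i = 0) ->
  forall q, (q + p <= L)%N -> d q != 0 -> (p %| q)%N.
Proof.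
move=> dL d1 d0 pL dp0 dlt q; have op := first_jump_odd dL pL dp0 dlt d0.
elim/ltn_ind: q => q IHq qL dq0; apply/negPn/negP => npq.
have mulp i : (i < q)%N -> d i != 0 -> (p %| i)%N.
  by move=> iq di0; apply: IHq => //; lia.
have lt_pq : (p < q)%N.
  case: (ltngtP p q) => // [qp|epq]; last by rewrite epq dvdnn in npq.
  by rewrite (dlt _ qp) eqxx in dq0.
have oq : odd q.
  apply: contraNT dq0 => eq; have := dL q _ eq.
  rewrite big1_seq ?addr0 => [->//|i]; first by lia.
  rewrite mem_index_iota => /andP[_] iq.
  have [->|i0] := posnP i; first by rewrite d0 mulr0 mul0r.
  have [->|di0] := eqVneq (d i) 0; first by rewrite mulr0 mul0r.
  have [->|dqi0] := eqVneq (d (q - i)%N) 0; first by rewrite mulr0.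
  have [eiq|niq] := eqVneq i q; first by rewrite eiq subnn d0 eqxx in dqi0.
  case/negP: npq; have -> : (q = i + (q - i))%N by lia.
  by rewrite dvdn_add // mulp //; lia.
pose m := (p + q)./2; have mE : (m.*2 = p + q)%N by lia.
have vanish i : (i < q)%N -> i != p -> d i * d (m.*2 - i)%N = 0.
  move=> iq nip.
  have [->|di0] := eqVneq (d i) 0; first by rewrite mul0r.
  have [->|dqi0] := eqVneq (d (m.*2 - i)%N) 0; first by rewrite mulr0.
  have pi : (p < i)%N.
    by case: (ltngtP p i) nip => // /dlt h; rewrite h eqxx in di0.
  case/negP: npq; rewrite -(dvdn_addr _ (dvdnn p)) -mE.
  have -> : (m.*2 = i + (m.*2 - i))%N by lia.
  by rewrite dvdn_add // mulp //; lia.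
have m2L : (m.*2 <= L)%N by lia.
have := jump_identity_half dL m2L.
have dm0 : d m * d m = 0.
  by have := vanish m; rewrite (_ : m.*2 - m = m)%N; [apply; lia | lia].
rewrite -mulrA dm0 mulr0 addr0.
rewrite (bigD1_seq p) ?iota_uniq ?mem_index_iota //=; last by lia.
rewrite big1_seq => [|i]; last first.
  rewrite mem_index_iota => /andP[nip im].
  by rewrite -mulrA vanish ?mulr0 //; lia.
have -> : (m.*2 - p = q)%N by lia.
have d1m := d1 _ m2L.
rewrite addr0 -signr_odd op expr1 mulr2n; nia.
Qed.

(** * Sign changes of a Barker sequence *)

Lemma jump_le1 n a k : signs n a -> (k < n)%N -> `|jump a k| <= 1.
Proof.
by move=> sa kn; rewrite /jump; case: eqP => // _; have [->|->] := sa k kn.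
Qed.

Lemma jump_eq0 n a k : signs n a -> (k < n)%N ->
  (jump a k == 0) = (a k == a k.-1).
Proof.
by move=> sa kn; rewrite /jump; case: ifP => // _; have [->|->] := sa k kn.
Qed.

(** By skew-symmetry [a_k a_(k-1) a_(n-k) a_(n-k-1) = -1]: of two mirror steps
exactly one is a sign change. *)
Lemma jump_mirror n a k : barker n a -> odd n -> (0 < k < n)%N ->
  (jump a (n - k)%N == 0) = (jump a k != 0).
Proof.
move=> bn on kn; have [sa _] := bn.
rewrite !(jump_eq0 sa); try lia.
have ltk : (k < n)%N by lia.
have ltk1 : (k.-1 < n)%N by lia.
have := barker_skew bn on ltk; have := barker_skew bn on ltk1.
have -> : (n.-1 - k.-1 = n - k)%N by lia.
have -> : (n.-1 - k = (n - k).-1)%N by lia.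
have -> : (-1) ^+ k = - (-1) ^+ k.-1 :> int by rewrite -{1}[k]prednK ?exprS; lia.
rewrite mulrN => <-.
have [->|->] := sa _ ltk; have [->|->] := sa _ ltk1.
all: have [|->|->] := sa (n - k)%N; first lia.
all: by have [|->|->] := sa (n - k).-1; first lia.
Qed.

(** Only the set [f] of positions of sign changes matters from here on. An odd [j]
outside [f] puts [n - j], hence [(n - j) / 2], into [f], so [p] divides
[(n - j) / 2]. The contradictions use [j = 3, 5] if [p > 6], [j = 3, 7] if
[p = 5] (where 7 is known to be outside [f] only for [n > 13]), and [j = 5, 7]
if [p = 3] (for [n > 11]). *)
Lemma jump_pattern_length n (f : nat -> bool) p :
    odd n -> (8 < n)%N ->
    (forall k, (0 < k < n)%N -> f (n - k)%N = ~~ f k) ->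
    (forall k, (k.*2 < n.-1)%N -> f k.*2 = f k) ->
    odd p -> (1 < p)%N -> f p -> (forall k, (k < p)%N -> ~~ f k) ->
    (forall q, (q + p < n.-1)%N -> f q -> (p %| q)%N) ->
  n = 11%N \/ n = 13%N.
Proof.
move=> on n8 mirror double op p1 fp lt_p mult.
have half j : odd j -> (2 < j < n)%N -> ~~ f j -> f (n - j)./2.
  move=> oj jn nfj; rewrite -double; last by lia.
  have -> : ((n - j)./2.*2 = n - j)%N by lia.
  by rewrite mirror //; lia.
(* For p > 3, otherwise (n - 3) / 2 would be a sign change before p. This bound keeps every
   (n - j) / 2 with j >= 3 in the range of [mult]. *)
have p_half : (p.*2 <= n - 3)%N.
  have [p3|p3] := ltnP 3 p; last by lia.
  have f3 : f (n - 3)./2 by rewrite half ?lt_p //; lia.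
  by case: (leqP p (n - 3)./2) => [|/lt_p/negP//]; lia.
have dvd j : odd j -> (2 < j < n)%N -> ~~ f j -> (p %| (n - j)./2)%N.
  by move=> oj jn nfj; apply: mult; [lia | apply: half].
have f_window q : (q + p < n.-1)%N -> ~~ (p %| q)%N -> ~~ f q.
  by move=> qn; apply: contra; apply: mult.
have not_consecutive i : (p %| i)%N -> (p %| i.+1)%N -> False.
  by move=> pi; rewrite -addn1 dvdn_addr // dvdn1; lia.
have [p6|p6] := ltnP 6 p.
  have h3 : (p %| (n - 3)./2)%N by rewrite dvd ?lt_p //; lia.
  have h5 : (p %| (n - 5)./2)%N by rewrite dvd ?lt_p //; lia.
  case: (not_consecutive _ h5); have -> // : ((n - 5)./2.+1 = (n - 3)./2)%N by lia.
have [p5|p3] : p = 5%N \/ p = 3%N by lia.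
  subst p; have h3 : (5 %| (n - 3)./2)%N by rewrite dvd ?lt_p //; lia.
  right; apply/eqP/negPn/negP => n13.
  have f7 : ~~ f 7%N by apply: f_window => //; lia.
  have := dvd 7%N isT _ f7; lia.
subst p; left.
(* For n = 9 the positions 3 and 6 are mirror images and also related by
   doubling. *)
have [n9|n9] := eqVneq n 9%N.
  subst n; have := mirror 3%N isT; rewrite /= fp.
  by have /= -> := double 3%N isT; rewrite fp.
apply/eqP/negPn/negP => n11.
have f5 : ~~ f 5%N by apply: f_window => //; lia.
have f7 : ~~ f 7%N by apply: f_window => //; lia.
have := dvd 5%N isT _ f5; have := dvd 7%N isT _ f7; lia.
Qed.

Lemma barker_length n a : barker n a -> odd n -> a 0%N = 1 -> a 1%N = 1 ->
  (8 < n)%N -> n = 11%N \/ n = 13%N.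
Proof.
move=> bn on a0 a1 n8; have [sa _] := bn.
pose d := jump a.
have dL : jump_identity (n - 2) d.
  by move=> N NL eN; apply: jump_conv bn on a0 _ eN; lia.
have d1 i : (i <= n - 2)%N -> `|d i| <= 1 by move=> iL; apply: jump_le1 sa _; lia.
have d0 : d 0%N = 0 by rewrite /d /jump eqxx.
have mirror k : (0 < k < n)%N -> (d (n - k)%N != 0) = ~~ (d k != 0).
  by move=> kn; rewrite (jump_mirror bn on kn).
have ex_jump : exists k, (k <= n - 2)%N && (d k != 0).
  have [d3|d3] := boolP (d 3%N != 0); first by exists 3%N; rewrite d3; lia.
  by exists (n - 3)%N; rewrite mirror ?d3; lia.
case: (ex_minnP ex_jump) => p /andP[pL dp0] pmin.
have dlt i : (i < p)%N -> d i = 0.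
  move=> ip; apply/eqP; apply: contraTT ip => di0; rewrite -leqNgt.
  by case: (leqP i p) => [ip|pi]; [apply: pmin; rewrite di0; lia | lia].
have op := first_jump_odd dL pL dp0 dlt d0.
apply: (@jump_pattern_length n (fun k => d k != 0) p) => //.
- move=> k kn; congr (~~ _); apply: (jump_double dL d1); lia.
- case: p op dp0 {pL pmin dlt} => [//|[|p]] // _.
  by rewrite /d /jump /= a0 a1.
- by move=> k /dlt ->; rewrite eqxx.
- move=> q qn; apply: (jumps_multiple dL d1 d0 pL dp0 dlt); lia.
Qed.

(** * Normalisation *)

Lemma barker_twist n a s t : barker n a -> (s = 1 \/ s = -1) -> (t = 1 \/ t = -1) ->
  barker n (fun k => s * t ^+ k * a k).
Proof.
move=> [sa Ca] hs ht; split=> [k kn | u un].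
  have [->|->] : t ^+ k = 1 \/ t ^+ k = -1.
  - case: ht => ->; rewrite ?expr1n; first by left.
    by rewrite -signr_odd; case: (odd k); [right | left].
  - by case: hs => ->; have [->|->] := sa k kn; [left|right|right|left].
  - by case: hs => ->; have [->|->] := sa k kn; [right|left|left|right].
have -> : acorr n (fun k => s * t ^+ k * a k) u = t ^+ u * acorr n a u.
  rewrite /acorr mulr_sumr; apply: eq_bigr => k _.
  have ss : s * s = 1 by case: hs => ->.
  have tt : t ^+ k * t ^+ k = 1 by rewrite -exprMn; case: ht => ->; rewrite expr1n.
  rewrite exprD.
  have -> : s * t ^+ k * a k * (s * (t ^+ k * t ^+ u) * a (k + u)%N)
    = (s * s) * (t ^+ k * t ^+ k) * (t ^+ u * (a k * a (k + u)%N)) by ring.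
  by rewrite ss tt !mul1r.
rewrite normrM normrX.
by have -> : `|t| = 1; [case: ht => -> | rewrite expr1n mul1r Ca].
Qed.

Lemma barker_of_sequence n (A : n.-tuple int) :
  barker_sequence A -> barker n (nth 0 A).
Proof.
move=> [n1 sA CA]; split=> [k kn | u un].
  by have := sA k.+1 kn; rewrite /entry /= => -[->|->]; [right | left].
have := CA u un; rewrite /autocorrelation big_add1 /=.
by rewrite /acorr.
Qed.

Local Close Scope ring_scope.

Theorem theorem1 (n : nat) (n_gt1 : 1 < n) (n_odd : odd n)
    (ex_barker : exists A : n.-tuple int, barker_sequence A) :
  n \in [:: 3; 5; 7; 11; 13].
Proof.
case: ex_barker => A /barker_of_sequence bA; have [sA _] := bA.
have [n_small|n_large] := leqP n 8; first by rewrite !inE; lia.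
have h0 : nth 0%R A 0 = 1%R \/ nth 0%R A 0 = (-1)%R by apply: sA; lia.
have h1 : nth 0%R A 1 = 1%R \/ nth 0%R A 1 = (-1)%R by apply: sA; lia.
(* These signs make the first two terms equal to 1. *)
pose s := nth 0%R A 0; pose t := (s * nth 0 A 1)%R.
have ht : t = 1%R \/ t = (-1)%R.
  rewrite /t /s; case: h0 => ->; case: h1 => ->; [left|right|right|left]; by [].
have bB := barker_twist bA h0 ht.
have [||->|->] // := barker_length bB n_odd _ _ n_large.
  by rewrite expr0 mulr1; case: h0 => ->.
by rewrite expr1 /t /s; case: h0 => ->; case: h1 => ->.
Qed.
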